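(* Let $P \in \mathbb{Z}[x]$ be a polynomial of degree $d \geq 2$, and let $(m_n)_{n \geq 1}$ be a sequence of pairwise distinct integers such that, for some $t \in \mathbb{N}$, $|m_n| \leq n^t$ for all $n \geq n(t)$. Then for almost all $\alpha \in \mathbb{R}$ (with respect to Lebesgue measure) the discrepancy $D_N$ of the sequence $(\{P(m_n)\alpha\})_{n \geq 1}$ satisfies the following: for every $\varepsilon > 0$ there are infinitely many $N$ with $$N D_N \geq N^{\frac12 - \varepsilon}.$$
   Context: For real $x$, $\{x\}$ denotes the fractional part of $x$. For a sequence $(x_n)_{n\ge1}$ in $[0,1)$, its discrepancy is $$D_N = \sup_{0 \leq a < b \leq 1} \left| \frac{A_N([a,b))}{N} - (b-a) \right|, \qquad A_N([a,b)) = \#\{1 \leq n \leq N : x_n \in [a,b)\}.$$ *)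

(* Defs.v *)
From Stdlib Require Import Reals Lra Lia ZArith Classical ClassicalEpsilon.
Open Scope R_scope.

Definition frac (x : R) : R := frac_part x.

Fixpoint count_in (x : nat -> R) (a b : R) (N : nat) : nat :=
  match N with
  | O => O
  | S k => (count_in x a b k +
            (if Rle_dec a (x (S k)) then (if Rlt_dec (x (S k)) b then 1 else 0) else 0))%nat
  end.

Definition lub_of (E : R -> Prop) : R :=
  match excluded_middle_informative (exists m, is_lub E m) with
  | left H => proj1_sig (constructive_indefinite_description _ H)
  | right _ => 0
  end.

Definition discr_set (x : nat -> R) (N : nat) (r : R) : Prop :=
  exists a b, 0 <= a /\ a < b /\ b <= 1 /\
    r = Rabs (INR (count_in x a b N) / INR N - (b - a)).

Definition discrepancy (x : nat -> R) (N : nat) : R := lub_of (discr_set x N).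

Definition null_set (S : R -> Prop) : Prop :=
  forall eps, 0 < eps ->
    exists a b : nat -> R,
      (forall k, a k <= b k) /\
      (forall y, S y -> exists k, a k < y < b k) /\
      (forall K, sum_f_R0 (fun k => b k - a k) K <= eps).

Fixpoint poly_evalZ (c : nat -> Z) (d : nat) (m : Z) : Z :=
  match d with
  | O => c O
  | S k => (poly_evalZ c k m + c (S k) * m ^ Z.of_nat (S k))%Z
  end.

(* Main.v *)
Require Import Defs.
From Stdlib Require Import Reals ZArith Lra Lia Classical ClassicalEpsilon Cantor.
From HB Require Import structures.
From mathcomp Require all_boot all_algebra zify ssrZ.

(** Let [p n = P(m_n)], [S_N(x) = sum_(n <= N) e(p n x)], and fix integers [H] and
    [N = H ^ (2 s)]. The mean energy [sum_(h <= H) |S_N(h x)|^2] equals the number of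
    triples [(h, a, b)] with [h (p a - p b) = 0], which is at least [H N], plus a
    cosine sum [F] over the non-zero values [h (p a - p b)]. A non-zero value [v] has at
    most [2 d tau(v)^2] representations, because [h] and [m_a - m_b] divide [v] and then
    [m_b] is a root of a fixed polynomial of degree [< d]. By the divisor bound and
    orthogonality the mean square of [F / (H N)] therefore tends to [0].
    By Koksma's inequality [|S_N(h x)|] is at most [O(h N D_N)], so a point with
    [N D_N < N ^ (1/2 - 1/s)] has [F(x) < - H N / 2], and by Chebyshev's inequality the
    set of these points is small. Averaging over [h] is what absorbs the loss
    [tau(v)^2] of the divisor bound. All averages are taken over a finite equidistant
    mesh, so no integration is needed. *)

Module MeanEnergy.

Import all_boot all_algebra zify ssrZ Defs.
Import GRing.Theory Num.Theory.
Set Implicit Arguments.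
Unset Strict Implicit.
Unset Printing Implicit Defensive.
Delimit Scope Z_scope with Z.
Local Open Scope nat_scope.

(** * Counting representations *)

(** A divisor [e] of [a * b] is the product of [gcdn e a], which divides [a], and [e %/ gcdn e a],
    which divides [b] by Gauss's lemma. *)
Lemma size_divisorsM a b : 0 < a -> 0 < b ->
  size (divisors (a * b)) <= size (divisors a) * size (divisors b).
Proof.
move=> a0 b0; rewrite -(size_allpairs muln).
apply: uniq_leq_size (divisors_uniq _) _ => e.
rewrite -dvdn_divisors ?muln_gt0 ?a0 // => e_ab.
have x0 : 0 < gcdn e a by rewrite gcdn_gt0 a0 orbT.
apply/allpairsP; exists (gcdn e a, e %/ gcdn e a) => /=; split.
- by rewrite -dvdn_divisors // dvdn_gcdr.
- rewrite -dvdn_divisors //.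
  have cop : coprime (e %/ gcdn e a) (a %/ gcdn e a).
    rewrite /coprime -(eqn_pmul2r x0) muln_gcdl mul1n.
    by rewrite !divnK ?dvdn_gcdl ?dvdn_gcdr.
  rewrite -(Gauss_dvdr _ cop) -(dvdn_pmul2r x0) divnK ?dvdn_gcdl //.
  by rewrite mulnAC divnK ?dvdn_gcdr.
- by rewrite mulnC divnK // dvdn_gcdl.
Qed.

Lemma size_divisors_pfactor p e : prime p -> size (divisors (p ^ e)) <= e.+1.
Proof.
move=> p_pr.
have -> : e.+1 = size [seq p ^ i | i <- iota 0 e.+1] by rewrite size_map size_iota.
apply: uniq_leq_size (divisors_uniq _) _ => x.
rewrite -dvdn_divisors ?expn_gt0 ?prime_gt0 // => /(dvdn_pfactor _ _ p_pr)[i ile ->].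
by apply: map_f; rewrite mem_iota.
Qed.

(** Division with remainder gives [e + 1 <= k (e %/ k + 1) <= k * 2 ^ (e %/ k)]; the [k]-th power of
    this is the claim. *)
Lemma succ_exp_bound k e : 0 < k -> e.+1 ^ k <= k ^ k * 2 ^ e.
Proof.
move=> k0.
have le1 : e.+1 <= k * 2 ^ (e %/ k).
  apply: (@leq_trans (k * (e %/ k).+1)).
    by rewrite mulnC ltn_ceil.
  by rewrite leq_mul2l (ltn_expl _ (isT : 1 < 2)) orbT.
apply: (@leq_trans ((k * 2 ^ (e %/ k)) ^ k)); first by rewrite leq_exp2r.
by rewrite expnMn -expnM leq_mul2l leq_exp2l // leq_trunc_div orbT.
Qed.

(* Peeling off the primes below 2 ^ k one at a time costs a factor k ^ k each;
   for the primes p >= 2 ^ k the factor (e + 1) ^ k is absorbed by p ^ e. *)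
Lemma size_divisors_rough k j n : 0 < k -> 0 < n ->
  (forall p, prime p -> p %| n -> 2 ^ k <= p + j) ->
  size (divisors n) ^ k <= (k ^ k) ^ j * n.
Proof.
move=> k0.
(* Adjoining [p ^ e] multiplies the number of divisors by at most [e + 1], so the constant [A] of
   the cofactor and the constant [B] of the prime power multiply. *)
have peel p n' e A B : prime p -> 0 < n' ->
    size (divisors n') ^ k <= A * n' -> e.+1 ^ k <= B * p ^ e ->
    size (divisors (n' * p ^ e)) ^ k <= (B * A) * (n' * p ^ e).
  move=> p_pr n'0 le1 le2; have pe0 : 0 < p ^ e by rewrite expn_gt0 prime_gt0.
  apply: (@leq_trans ((size (divisors n') * e.+1) ^ k)).
    rewrite leq_exp2r //; apply: leq_trans (size_divisorsM n'0 pe0) _.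
    by rewrite leq_mul2l size_divisors_pfactor ?orbT.
  by rewrite expnMn (leq_trans (leq_mul le1 le2)) //; lia.
elim: j n => [|j IHj] n n0 big.
  rewrite expn0 mul1n; elim/ltn_ind: n n0 big => n IHn n0 big.
  have [n_le1|n_gt1] := leqP n 1.
    have -> : n = 1 by lia.
    by rewrite exp1n.
  have p_pr := pdiv_prime n_gt1; set p := pdiv n in p_pr.
  have [n' n'p nE] := pfactor_coprime p_pr n0.
  have e0 : 0 < logn p n by rewrite logn_gt0 mem_primes p_pr n0 pdiv_dvd.
  have pe1 : 1 < p ^ logn p n by rewrite -{1}(expn0 p) ltn_exp2l // prime_gt1.
  have n'0 : 0 < n' by move: n0; rewrite nE muln_gt0 => /andP[].
  have pk : 2 ^ k <= p by rewrite -[p]addn0 big // pdiv_dvd.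
  (* All primes are at least [2 ^ k] here, so each prime power is removed with [A = B = 1]. *)
  rewrite nE -[leqRHS]mul1n -[1]mul1n; apply: peel => //.
    rewrite mul1n; apply: IHn => //.
      by rewrite [ltnRHS]nE -[ltnLHS]muln1 ltn_pmul2l.
    by move=> q q_pr qn'; apply: big => //; rewrite nE dvdn_mulr.
  rewrite mul1n; apply: (@leq_trans ((2 ^ logn p n) ^ k)).
    by rewrite leq_exp2r // (ltn_expl _ (isT : 1 < 2)).
  by rewrite -expnM mulnC expnM leq_exp2r.
(* [2 ^ k - j.+1] is the only prime that the hypothesis for [j.+1] admits and that for [j]
   excludes. *)
have [q_n|q_n] := boolP (prime (2 ^ k - j.+1) && (2 ^ k - j.+1 %| n)); last first.
  apply: leq_trans (IHj n n0 _) _ => [p p_pr pn|].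
    have := big p p_pr pn; rewrite leq_eqVlt => /orP[/eqP pE|]; last by rewrite addnS ltnS.
    case/negP: q_n; have -> : 2 ^ k - j.+1 = p by rewrite pE addnK.
    by rewrite p_pr pn.
  by rewrite leq_mul2r leq_pexp2l ?expn_gt0 ?k0 ?orbT.
have [/andP[]] := (q_n, tt); set q := 2 ^ k - j.+1 => q_pr qn _.
have [n' n'q nE] := pfactor_coprime q_pr n0.
have n'0 : 0 < n' by move: n0; rewrite nE muln_gt0 => /andP[].
rewrite nE expnS; apply: peel => //.
  apply: IHj => // p p_pr pn'.
  have pn : p %| n by rewrite nE dvdn_mulr.
  have := big p p_pr pn; rewrite leq_eqVlt => /orP[/eqP pE|]; last by rewrite addnS ltnS.
  have pq : p = q by rewrite /q pE addnK.
  by move: n'q; rewrite -pq prime_coprime // pn'.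
apply: leq_trans (succ_exp_bound _ k0) _.
by rewrite leq_mul2l; apply/orP; right; case: (logn q n) => // e; rewrite leq_exp2r // prime_gt1.
Qed.

(** For [j = 2 ^ k] the restriction on the primes in [size_divisors_rough] is void. *)
Lemma divisor_bound k : 0 < k -> exists2 C, 0 < C &
  forall n, 0 < n -> size (divisors n) ^ k <= C * n.
Proof.
move=> k0; exists ((k ^ k) ^ (2 ^ k)); first by rewrite !expn_gt0 k0.
by move=> n n0; apply: size_divisors_rough => // p _ _; rewrite leq_addl.
Qed.

(** * Roots of shifted differences of a polynomial *)

Section Shift.
Local Open Scope ring_scope.

Lemma poly0_infinite_roots (R : numDomainType) (p : {poly R}) :
  (forall j : nat, p.[j%:R] = 0) -> p = 0.
Proof.
move=> root_p; apply: (@roots_geq_poly_eq0 _ _ [seq j%:R | j <- iota 0 (size p)]).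
- by apply/allP=> _ /mapP[j _ ->]; apply/rootP.
- by rewrite map_inj_uniq ?iota_uniq // => i j /eqP; rewrite eqr_nat => /eqP.
- by rewrite size_map size_iota.
Qed.

(* If p (x + k) - p x were the constant u, then p (j k) = p 0 + j u for all j. *)
Lemma shift_diff_roots (R : numDomainType) (p : {poly R}) (k u : R) (s : seq R) :
  (2 < size p)%N -> k != 0 -> uniq s ->
  {in s, forall x, p.[x + k] - p.[x] = u} -> (size s < size p)%N.
Proof.
move=> p2 k0 s_uniq s_root.
pose q := p \Po ('X + k%:P) - p - u%:P.
have q_ev x : q.[x] = p.[x + k] - p.[x] - u by rewrite /q !(hornerE, horner_comp).
have q0 : q != 0.
  apply/eqP => qE.
  have pj (j : nat) : p.[k * j%:R] = p.[0] + u * j%:R.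
    elim: j => [|j IHj]; first by rewrite !mulr0 addr0.
    have := q_ev (k * j%:R); rewrite qE horner0 => /esym/eqP.
    rewrite subr_eq add0r subr_eq IHj => /eqP.
    by rewrite -natr1 !mulrDr !mulr1 => ->; rewrite addrC addrA.
  (* A polynomial vanishing at all natural numbers is zero, so [p (k X)] is affine; this contradicts
     [2 < size p], because [k != 0] preserves the size. *)
  have rE : p \Po (k *: 'X) - (u *: 'X + p.[0]%:P) = 0.
    apply: poly0_infinite_roots => j.
    by rewrite !(hornerE, horner_comp) pj [u * _ + _]addrC subrr.
  have sz : size (p \Po (k *: 'X)) = size p.
    by rewrite size_comp_poly2 // size_scale // size_polyX.
  move/eqP: rE; rewrite subr_eq0 => /eqP rE.
  have : (size (p \Po (k *: 'X)%R) <= 2)%N.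
    rewrite rE (leq_trans (size_polyD _ _)) // geq_max.
    rewrite (leq_trans (size_scale_leq _ _)) ?size_polyX //=.
    by rewrite (leq_trans (size_polyC_leq1 _)).
  by rewrite sz leqNgt p2.
have : (size s < size q)%N.
  apply: max_poly_roots => //; apply/allP => x xs.
  by apply/rootP; rewrite q_ev (s_root _ xs) subrr.
move=> lt_s; apply: leq_trans lt_s _.
rewrite /q (leq_trans (size_polyD _ _)) // geq_max size_polyN.
rewrite (leq_trans (size_polyD _ _)) /=; last first.
  by rewrite geq_max size_polyN leqnn andbT size_comp_poly2 // size_XaddC.
by rewrite (leq_trans (size_polyC_leq1 _)) // (leq_trans _ p2).
Qed.
End Shift.

Lemma size_fibres (A B : eqType) (f : A -> B) (s : seq A) (t : seq B) (d : nat) :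
  {in s, forall x, f x \in t} -> {in t, forall y, count (fun x => f x == y) s <= d} ->
  size s <= size t * d.
Proof.
elim: t s => [|y t IHt] s s_t fib /=.
  by case: s s_t {fib} => // x s /(_ x (mem_head _ _)).
rewrite -(count_predC (fun x => f x == y) s) mulSn leq_add ?fib ?mem_head //.
rewrite -size_filter; apply: IHt => [x|z zt].
  by rewrite mem_filter => /andP[/= fx /s_t]; rewrite inE (negPf fx).
rewrite (leq_trans _ (fib z _)) ?inE ?zt ?orbT // count_filter.
by apply: sub_count => x /andP[].
Qed.

Lemma poly_evalZE (c : nat -> Z) d (x : Z) :
  poly_evalZ c d x = (\poly_(i < d.+1) c i).[x]%R.
Proof.
rewrite horner_poly; elim: d => [|d IHd]; first by rewrite big_ord1 /= expr0 mulr1.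
transitivity (poly_evalZ c d x + c d.+1 * x ^ Z.of_nat d.+1)%Z => //.
rewrite big_ord_recr -IHd; congr (Z.add _ (Z.mul _ _)).
rewrite [nat_of_ord _]/=.
elim: (d.+1) => // n IHn; rewrite Nat2Z.inj_succ Z.pow_succ_r ?IHn ?exprS //; lia.
Qed.

Lemma divide_poly_evalZ (c : nat -> Z) d (x y : Z) :
  Z.divide (x - y) (poly_evalZ c d x - poly_evalZ c d y).
Proof.
have pow_div n : Z.divide (x - y) (x ^ Z.of_nat n - y ^ Z.of_nat n).
  elim: n => [|n [z IHn]]; first by exists 0%Z.
  rewrite Nat2Z.inj_succ !Z.pow_succ_r; try lia.
  by exists (x * z + y ^ Z.of_nat n)%Z; nia.
elim: d => [|d [z IHd]]; first by exists 0%Z => /=; lia.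
have [z' Hz'] := pow_div d.+1.
by exists (z + c d.+1 * z')%Z; rewrite /poly_evalZ -/poly_evalZ; nia.
Qed.

Lemma divide_abs_nat (x y : Z) : y <> 0%Z -> Z.divide x y ->
  Z.abs_nat x \in divisors (Z.abs_nat y).
Proof.
move=> y0 [z yE]; rewrite -dvdn_divisors; last by lia.
by rewrite yE Zabs2Nat.inj_mul dvdn_mull.
Qed.

(** * Multiplicity of a non-zero frequency *)

Definition triples (H N : nat) : seq (nat * (nat * nat)) :=
  [seq (h, ab) | h <- iota 1 H, ab <- [seq (a, b) | a <- iota 1 N, b <- iota 1 N]].

(** The frequency contributed by the triple when the squares [|S_N(h x)|^2] are expanded into double
    sums. *)
Definition freq (p : nat -> Z) (t : nat * (nat * nat)) : Z :=
  (Z.of_nat t.1 * (p t.2.1 - p t.2.2))%Z.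

Lemma mem_triples H N h a b :
  ((h, (a, b)) \in triples H N) = [&& 0 < h <= H, 0 < a <= N & 0 < b <= N].
Proof.
apply/allpairsP/idP => [[[h' [a' b']] /= [hH]]|/and3P[hH aN bN]].
  move=> /allpairsP[[a2 b2] /= [aN bN [-> ->]]] [-> -> ->].
  by move: hH aN bN; rewrite !mem_iota; lia.
exists (h, (a, b)); rewrite /= mem_iota; split=> //.
by apply/allpairsP; exists (a, b); rewrite /= !mem_iota; split.
Qed.

Lemma triples_uniq H N : uniq (triples H N).
Proof.
apply: allpairs_uniq; rewrite ?iota_uniq //; last by move=> [? ?] [? ?] _ _ [-> ->].
by apply: allpairs_uniq; rewrite ?iota_uniq //; move=> [? ?] [? ?] _ _ [-> ->].
Qed.

(* For h (P(m_a) - P(m_b)) = v both h and m_a - m_b divide v, and they leave at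
   most d values of m_b. *)
Lemma count_freq (c m : nat -> Z) (d H N : nat) (v : Z) :
  2 <= d -> c d <> 0%Z -> v <> 0%Z ->
  (forall i j, 0 < i -> 0 < j -> m i = m j -> i = j) ->
  count (fun t => freq (fun n => poly_evalZ c d (m n)) t == v) (triples H N)
    <= 2 * size (divisors (Z.abs_nat v)) ^ 2 * d.
Proof.
move=> d2 cd v0 m_inj; set p := (X in freq X).
pose D := divisors (Z.abs_nat v).
(* Divisors of both signs, since [m a - m b] may be negative; this is the factor 2 in the bound. *)
pose ks := [seq Z.of_nat e | e <- D] ++ [seq (- Z.of_nat e)%Z | e <- D].
have memks k : Z.abs_nat k \in D -> k \in ks.
  move=> kD; rewrite mem_cat; have [k0|k0] := Z.le_gt_cases 0 k.
    by apply/orP; left; apply/mapP; exists (Z.abs_nat k) => //; lia.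
  by apply/orP; right; apply/mapP; exists (Z.abs_nat k) => //; lia.
have ks0 k : k \in ks -> k <> 0%Z.
  by rewrite mem_cat => /orP[] /mapP[e]; rewrite -dvdn_divisors; try lia; case: e => [|e]; lia.
have -> : 2 * size D ^ 2 = size [seq (h, k) | h <- D, k <- ks].
  by rewrite size_allpairs size_cat !size_map; lia.
rewrite -size_filter.
apply: (@size_fibres _ _ (fun t => (t.1, (m t.2.1 - m t.2.2)%Z))).
  move=> [h [a b]]; rewrite mem_filter /freq /= mem_triples => /andP[/eqP vE _].
  apply/allpairsP; exists (h, (m a - m b)%Z); split=> //=.
    by rewrite -(Zabs2Nat.id h); apply: divide_abs_nat => //; exists (p a - p b)%Z; lia.
  apply/memks/divide_abs_nat => //; rewrite -vE; apply: Z.divide_mul_r.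
  exact: divide_poly_evalZ.
move=> [h k] /allpairsP[[h' k'] /= [_ /ks0 k0 [-> ?]]]; subst k'.
rewrite -size_filter; set s := filter _ _.
have s_in t : t \in s -> [/\ 0 < h', 0 < t.2.1, 0 < t.2.2, t.1 = h' & 
    (m t.2.1 - m t.2.2 = k /\ freq p t = v)%Z].
  case: t => t1 [a b]; rewrite !mem_filter /= mem_triples.
  by move=> /andP[/eqP[<- <-] /andP[/eqP <- /and3P[]]]; split=> //; lia.
(* In a fibre [h] and [k = m a - m b] are fixed and [m] is injective, so the value [m b] determines
   the triple; these values are roots of [P (X + k) - P X = v / h]. *)
rewrite -(size_map (fun t => m t.2.2)) -ltnS.
pose P : {poly Z} := (\poly_(i < d.+1) c i)%R.
have sP : size P = d.+1 by rewrite size_poly_eq //; apply/eqP.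
rewrite -sP; apply: (@shift_diff_roots _ _ k (v / Z.of_nat h')%Z).
- by rewrite sP.
- exact/eqP.
- rewrite map_inj_in_uniq ?filter_uniq ?triples_uniq //.
  move=> [t1 [a b]] [u1 [a' b']] /s_in[/= _ ap bp -> [mk _]] /s_in[/= _ ap' bp' -> [mk' _]].
  move=> /(m_inj _ _ bp bp') bb; subst b'.
  by congr (_, (_, _)); apply: m_inj => //; lia.
- move=> _ /mapP[[t1 [a b]] /s_in[/= h0 _ _ -> [mk vE]] ->].
  have -> : (m b + k)%R = m a by rewrite /GRing.add /=; lia.
  rewrite -!poly_evalZE -vE /freq /= Z.mul_comm Z.div_mul //; lia.
Qed.

Delimit Scope R_scope with R.
Local Open Scope R_scope.

(** * Finite trigonometric sums *)

Fact Rplus_assoc_ssr : associative Rplus.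
Proof. by move=> x y z; ring. Qed.

HB.instance Definition _ :=
  Monoid.isComLaw.Build R 0 Rplus Rplus_assoc_ssr Rplus_comm Rplus_0_l.
HB.instance Definition _ := Monoid.isMulLaw.Build R 0 Rmult Rmult_0_l Rmult_0_r.
HB.instance Definition _ :=
  Monoid.isAddLaw.Build R Rmult Rplus Rmult_plus_distr_r Rmult_plus_distr_l.

Reserved Notation "\rsum_ ( i <- r ) F" (at level 34, F at level 41, i, r at level 60).
Notation "\rsum_ ( i <- r ) F" := (\big[Rplus/0]_(i <- r) F) : R_scope.

Lemma rsum_le (I : eqType) (r : seq I) (F G : I -> R) :
  {in r, forall i, F i <= G i} -> \rsum_(i <- r) F i <= \rsum_(i <- r) G i.
Proof.
elim: r => [|i r IHr] le_FG; first by rewrite !big_nil; lra.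
rewrite !big_cons; apply: Rplus_le_compat; first by apply: le_FG; rewrite mem_head.
by apply: IHr => j jr; apply: le_FG; rewrite inE jr orbT.
Qed.

Lemma rsum_const I (r : seq I) (x : R) : \rsum_(i <- r) x = INR (size r) * x.
Proof.
elim: r => [|i r IHr]; first by rewrite big_nil /=; lra.
by rewrite big_cons IHr -[size (i :: r)]/((size r).+1) S_INR; ring.
Qed.

Lemma rsum_abs I (r : seq I) (F : I -> R) :
  Rabs (\rsum_(i <- r) F i) <= \rsum_(i <- r) Rabs (F i).
Proof.
elim: r => [|i r IHr]; first by rewrite !big_nil Rabs_R0; lra.
by rewrite !big_cons; apply: Rle_trans (Rabs_triang _ _) _; lra.
Qed.

Lemma rsum_scal I (r : seq I) (x : R) (F : I -> R) :
  \rsum_(i <- r) (x * F i) = x * \rsum_(i <- r) F i.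
Proof. by rewrite big_distrr. Qed.

Lemma rsum_sub I (r : seq I) (F G : I -> R) :
  \rsum_(i <- r) (F i - G i) = \rsum_(i <- r) F i - \rsum_(i <- r) G i.
Proof.
by elim: r => [|i r IHr]; rewrite ?big_nil ?big_cons ?IHr; lra.
Qed.

Lemma rsum_count I (r : seq I) (P : pred I) :
  \rsum_(i <- r) (if P i then 1 else 0) = INR (count P r).
Proof.
elim: r => [|i r IHr]; first by rewrite big_nil.
by rewrite big_cons IHr [count _ _]/= plus_INR; case: (P i).
Qed.

Lemma sin_mult_PI (k : Z) : sin (IZR k * PI) = 0.
Proof. by apply: sin_eq_0_1; exists k. Qed.

Lemma cos_periodZ (x : R) (k : Z) : cos (x + 2 * PI * IZR k) = cos x.
Proof.
have -> : 2 * PI * IZR k = 2 * (IZR k * PI) by ring.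
by rewrite cos_plus cos_2a_sin sin_2a sin_mult_PI; ring.
Qed.

Lemma sin_cos_shift (x : R) : sin x = cos (x + - (PI / 2)).
Proof.
by rewrite -cos_shift -cos_neg; congr cos; lra.
Qed.

Lemma sin_periodZ (x : R) (k : Z) : sin (x + 2 * PI * IZR k) = sin x.
Proof.
by rewrite !sin_cos_shift -[RHS](cos_periodZ _ k); congr cos; ring.
Qed.

Lemma cos_lipschitz (x y : R) : Rabs (cos x - cos y) <= Rabs (x - y).
Proof.
have sin_le z : Rabs (sin z) <= Rabs z.
  have pos t : 0 <= t -> Rabs (sin t) <= t.
    move=> t0; apply: Rabs_le; case: (Req_dec t 0) => [->|tn0]; first by rewrite sin_0; lra.
    have := sin_lt_x t; have := SIN_bound t; case: (Rle_dec t PI) => tPI.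
      by have := sin_ge_0 t t0 tPI; lra.
    by have := PI2_1; lra.
  case: (Rle_dec 0 z) => z0; first by rewrite [in X in _ <= X]Rabs_pos_eq //; apply: pos.
  by rewrite -Rabs_Ropp -sin_neg -(Rabs_Ropp z) [in X in _ <= X]Rabs_pos_eq; [apply: pos|]; lra.
rewrite form2.
have -> : -2 * sin ((x - y) / 2) * sin ((x + y) / 2) =
          2 * (- (sin ((x - y) / 2) * sin ((x + y) / 2))) by ring.
rewrite Rabs_mult Rabs_Ropp Rabs_mult (Rabs_pos_eq 2); last by lra.
have h1 := sin_le ((x - y) / 2).
have h2 : Rabs (sin ((x + y) / 2)) <= 1 by apply: Rabs_le; have := SIN_bound ((x + y) / 2); lra.
have : Rabs ((x - y) / 2) = Rabs (x - y) / 2.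
  by rewrite /Rdiv Rabs_mult (Rabs_pos_eq (/ 2)); lra.
have := Rabs_pos (sin ((x - y) / 2)); have := Rabs_pos (sin ((x + y) / 2)).
by nra.
Qed.

Lemma rsum_iotaS (F : nat -> R) (m n : nat) :
  \rsum_(i <- iota m n.+1) F i = \rsum_(i <- iota m n) F i + F (m + n)%N.
Proof. by rewrite -addn1 iotaD big_cat big_seq1. Qed.

(** The factor [2 * sin (theta / 2)] turns each cosine into a difference of two sines half a step to
    either side. *)
Lemma rsum_cos_telescope (theta phi : R) (n : nat) :
  2 * sin (theta / 2) * \rsum_(i <- iota 0 n) cos (theta * INR i + phi) =
  sin (theta * INR n - theta / 2 + phi) - sin (phi - theta / 2).
Proof.
elim: n => [|n IHn].
  rewrite big_nil /= !Rmult_0_r.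
  have -> : 0 - theta / 2 + phi = phi - theta / 2 by lra.
  by lra.
rewrite rsum_iotaS add0n Rmult_plus_distr_l IHn S_INR.
set y := theta * INR n + phi.
have -> : theta * INR n - theta / 2 + phi = y - theta / 2 by rewrite /y; lra.
have -> : theta * (INR n + 1) - theta / 2 + phi = y + theta / 2 by rewrite /y; lra.
by rewrite [sin (y - _)]sin_minus sin_plus; ring.
Qed.

(** Over [q * K] steps the argument advances by a multiple of [2 * PI], so the telescoped side
    vanishes; the factor [sin (PI * w / K)] is zero only if [K] divides [w]. *)
Lemma rsum_cos_period (K q : nat) (w : Z) (phi : R) :
  (0 < K)%N -> ~ Z.divide (Z.of_nat K) w ->
  \rsum_(i <- iota 0 (q * K)) cos (2 * PI * IZR w / INR K * INR i + phi) = 0.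
Proof.
move=> K0 ndvd; have K0' : 0 < INR K by apply: lt_0_INR; lia.
have := rsum_cos_telescope (2 * PI * IZR w / INR K) phi (q * K).
set theta := 2 * PI * IZR w / INR K.
have -> : theta * INR (q * K) - theta / 2 + phi =
    phi - theta / 2 + 2 * PI * IZR (w * Z.of_nat q).
  by rewrite mult_IZR -INR_IZR_INZ mult_INR /theta; field; lra.
rewrite sin_periodZ Rminus_diag => /Rmult_integral[s0|] //.
exfalso; apply: ndvd; have /sin_eq_0_0[k kE] : sin (theta / 2) = 0 by lra.
exists k; apply: eq_IZR; rewrite mult_IZR -INR_IZR_INZ.
have PI0 := PI_RGT_0; apply: (Rmult_eq_reg_r (PI / INR K)).
  by rewrite [RHS](_ : _ = IZR k * PI); [rewrite -kE /theta; field|field]; lra.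
by apply: Rgt_not_eq; apply: Rdiv_lt_0_compat.
Qed.

(** Frequencies are listed with repetition: the multiplicity of a value in [r] acts as its
    coefficient. *)
Definition cos_sum (r : seq Z) (x : R) : R := \rsum_(w <- r) cos (2 * PI * IZR w * x).

(** Discrete orthogonality: the square is a double sum of cosines of frequencies [w + w'] and
    [w - w'], whose mesh sums vanish unless [w'] is [- w] or [w], and each of these occurs at most
    [M] times. *)
Lemma cos_sum_second_moment (r : seq Z) (W K q M : nat) (z : Z) :
  (2 * W < K)%N -> {in r, forall w, w <> 0%Z /\ (Z.abs_nat w <= W)%N} ->
  (forall v, v <> 0%Z -> (count (pred1 v) r <= M)%N) ->
  \rsum_(i <- iota 0 (q * K)) (cos_sum r (IZR z + INR i / INR K)) ^ 2 <=
  INR (q * K) * INR M * INR (size r).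
Proof.
move=> WK rW rM; set n := (q * K)%N.
have K0 : (0 < K)%N by lia.
have K0' : 0 < INR K by apply: lt_0_INR; lia.
pose S v := \rsum_(i <- iota 0 n) cos (2 * PI * IZR v / INR K * INR i + 2 * PI * IZR (v * z)).
(* No aliasing: [2 * W < K] keeps every [w + w'] and [w - w'] below [K] in absolute value, so [K]
   divides one of them only if it is zero. *)
have SE v : (Z.abs v < Z.of_nat K)%Z -> S v = INR n * if v == 0%Z then 1 else 0.
  move=> vK; case: eqP => [->|v0].
    rewrite -(size_iota 0 n) -rsum_const; apply: eq_bigr => i _.
    by rewrite -[RHS]cos_0; congr cos; rewrite Z.mul_0_l; field; lra.
  rewrite Rmult_0_r /S rsum_cos_period // => -[k vE].
  have [k0|k0] : (k = 0 \/ Z.abs k >= 1)%Z by lia.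
    by apply: v0; rewrite vE k0.
  by move: vK; rewrite vE Z.abs_mul; nia.
have expand i : (cos_sum r (IZR z + INR i / INR K)) ^ 2 =
  \rsum_(w <- r) \rsum_(w' <- r) (/ 2 *
    (cos (2 * PI * IZR (w + w') / INR K * INR i + 2 * PI * IZR ((w + w') * z)) +
     cos (2 * PI * IZR (w - w') / INR K * INR i + 2 * PI * IZR ((w - w') * z)))).
  rewrite /cos_sum /= Rmult_1_r big_distrlr /=.
  apply: eq_bigr => w _; apply: eq_bigr => w' _.
  set a := 2 * PI * IZR w * _; set b := 2 * PI * IZR w' * _.
  rewrite (_ : _ + _ * IZR ((w + w') * z) = a + b); last first.
    by rewrite /a /b !mult_IZR !plus_IZR; field; lra.
  rewrite (_ : _ + _ * IZR ((w - w') * z) = a - b); last first.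
    by rewrite /a /b !mult_IZR !minus_IZR; field; lra.
  by rewrite cos_plus cos_minus; field.
rewrite (eq_bigr _ (fun i _ => expand i)) exchange_big /=.
rewrite [X in _ <= X](_ : _ = \rsum_(w <- r) (INR n * INR M)); last first.
  by rewrite rsum_const; ring.
apply: rsum_le => w wr; rewrite exchange_big /=.
rewrite (eq_bigr (fun w' => / 2 * (S (w + w')%Z + S (w - w')%Z))); last first.
  by move=> w' _; rewrite rsum_scal big_split.
rewrite rsum_scal big_split /=.
have [w0 wW] := rW w wr.
have half (f : Z -> Z) v : v <> 0%Z -> {in r, forall w', (Z.abs (f w') < Z.of_nat K)%Z} ->
    (forall w', (f w' == 0%Z) = (w' == v)) -> \rsum_(w' <- r) S (f w') <= INR n * INR M.
  move=> v0 fK fv; rewrite big_seq (eq_bigr (fun w' => INR n * if w' == v then 1 else 0)).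
    rewrite -big_seq rsum_scal rsum_count; apply: Rmult_le_compat_l; first exact: pos_INR.
    by apply: le_INR; apply/leP; apply: rM.
  by move=> w' /fK w'K; rewrite SE // fv.
have le1 := half (fun w' => w + w')%Z (- w)%Z.
have le2 := half (fun w' => w - w')%Z w.
have /le1 h1 : (- w)%Z <> 0%Z by lia.
suff : \rsum_(w' <- r) S (w + w')%Z <= INR n * INR M /\
       \rsum_(w' <- r) S (w - w')%Z <= INR n * INR M by lra.
split; [apply: h1|apply: le2 => //].
- by move=> w' /rW[_ w'W]; lia.
- by move=> w'; apply/eqP/eqP; lia.
- by move=> w' /rW[_ w'W]; lia.
- by move=> w'; apply/eqP/eqP; lia.
Qed.

(** * Koksma's inequality for the cosine *)

Lemma Rdiv_le_of_le_mul (a b c : R) : 0 < b -> a <= c * b -> a / b <= c.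
Proof.
move=> b0 le_ab; apply: (Rmult_le_reg_r b) => //.
by rewrite (_ : a / b * b = a) //; field; lra.
Qed.

Lemma count_in_le x a b N : (count_in x a b N <= N)%N.
Proof.
elim: N => //= N IHN; case: Rle_dec => ?; [case: Rlt_dec => ?|]; rewrite /addn /=; lia.
Qed.

Lemma discrepancy_ge (x : nat -> R) (N : nat) (a b : R) :
  (0 < N)%N -> 0 <= a -> a < b -> b <= 1 ->
  Rabs (INR (count_in x a b N) - INR N * (b - a)) <= INR N * discrepancy x N.
Proof.
move=> N0 a0 ab b1; have N0' : 0 < INR N by apply: lt_0_INR; lia.
(* [lub_of] defaults to 0 when there is no least upper bound, so existence has to be secured first;
   the set is bounded by 1. *)
have ex_lub : exists m, is_lub (discr_set x N) m.
  have bnd : bound (discr_set x N).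
    exists 1 => _ [a' [b' [? [? [? ->]]]]]; apply: Rabs_le.
    have := pos_INR (count_in x a' b' N).
    have := le_INR _ _ (elimT leP (count_in_le x a' b' N)) => h1 h2.
    have h3 : 0 <= INR (count_in x a' b' N) / INR N by apply: Rle_mult_inv_pos.
    have : INR (count_in x a' b' N) / INR N <= 1 by apply: Rdiv_le_of_le_mul; lra.
    by lra.
  have [|m lub_m] := completeness _ bnd; last by exists m.
  by exists (Rabs (INR (count_in x a b N) / INR N - (b - a))), a, b.
have [ub _] : is_lub (discr_set x N) (discrepancy x N).
  rewrite /discrepancy /lub_of; case: excluded_middle_informative => // H.
  by case: constructive_indefinite_description.
have /ub le_D : discr_set x N (Rabs (INR (count_in x a b N) / INR N - (b - a))).
  by exists a, b.
rewrite [X in Rabs X](_ : _ = INR N * (INR (count_in x a b N) / INR N - (b - a))).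
  by rewrite Rabs_mult (Rabs_pos_eq (INR N)); [apply: Rmult_le_compat_l|]; lra.
by field; lra.
Qed.

Lemma count_in_rsum (x : nat -> R) (b : R) (N : nat) :
  (forall n, 0 <= x n) ->
  INR (count_in x 0 b N) = \rsum_(n <- iota 1 N) (if Rlt_dec (x n) b then 1 else 0).
Proof.
move=> x0; elim: N => [|N IHN]; first by rewrite big_nil.
rewrite rsum_iotaS -IHN plus_INR; congr (_ + _); rewrite add1n.
by case: Rle_dec => // ?; case: Rlt_dec.
Qed.

Section Koksma.
Variables (g : R -> R) (L : R) (K : nat).
Hypotheses (K_gt0 : (0 < K)%N) (g_lip : forall y z, Rabs (g y - g z) <= L * Rabs (y - z)).

Let node (j : nat) : R := INR j / INR K.
Let incr (j : nat) : R := g (node j.+1) - g (node j).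
Let K0 : 0 < INR K. Proof. by apply: lt_0_INR; lia. Qed.
Let nodeS j : node j.+1 = node j + / INR K.
Proof. by rewrite /node S_INR; field; lra. Qed.

(** The increments with [y < node j.+1] telescope back from [g (node J)] to the value of [g] at the
    last node not exceeding [y], which is within [1 / K] of [y]. *)
Lemma step_approximation (y : R) (J : nat) : 0 <= y ->
  if Rlt_dec y (node J)
  then Rabs (g (node J) - \rsum_(j <- iota 0 J) (if Rlt_dec y (node j.+1) then incr j else 0)
             - g y) <= L / INR K
  else \rsum_(j <- iota 0 J) (if Rlt_dec y (node j.+1) then incr j else 0) = 0.
Proof.
move=> y0; elim: J => [|J IHJ].
  case: (Rlt_dec y (node 0)) => [lt0|ge0]; last by rewrite big_nil.
  by exfalso; move: lt0; rewrite /node /= /Rdiv Rmult_0_l; lra.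
rewrite rsum_iotaS add0n; have := nodeS J; have iK : 0 < / INR K by apply: Rinv_0_lt_compat.
case: (Rlt_dec y (node J)) IHJ => [ltJ|geJ] /= IHJ nodeE;
  case: (Rlt_dec y (node J.+1)) => [ltS|geS] /=; try (exfalso; lra).
- apply: Rle_trans IHJ; right; congr Rabs; set G := \rsum_(_ <- _) _.
  by rewrite /incr; ring.
- rewrite IHJ /incr Rplus_0_l (_ : _ - _ - _ = g (node J) - g y); last by ring.
  apply: Rle_trans (g_lip _ _) _.
  have L0 : 0 <= L.
    by have := g_lip 1 0; have := Rabs_pos (g 1 - g 0); rewrite Rminus_0_r Rabs_R1; lra.
  by apply: Rmult_le_compat_l => //; rewrite Rabs_minus_sym Rabs_pos_eq; lra.
- by rewrite IHJ; lra.
Qed.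

(** Summation by parts. For [J = K] and vanishing node sum the value is [K * g 1], which lets the
    term [g 1] be rewritten through the expected counts [N * node j.+1]. *)
Lemma abel_incr (J : nat) :
  \rsum_(j <- iota 0 J) (incr j * INR j.+1) =
  INR J * g (node J) - \rsum_(j <- iota 0 J) g (node j).
Proof.
elim: J => [|J IHJ]; first by rewrite !big_nil /=; lra.
by rewrite !rsum_iotaS IHJ add0n /incr S_INR; ring.
Qed.

(** Up to an error [L / K] per point, [g] is a step function whose sum is a combination of [K]
    counting errors, each at most [E] and weighted by an increment of size at most [L / K]. The
    vanishing node sum stands in for a vanishing integral. *)
Lemma koksma_step (x : nat -> R) (N : nat) (E : R) :
  (forall n, 0 <= x n < 1) ->
  (forall b, 0 < b <= 1 -> Rabs (INR (count_in x 0 b N) - INR N * b) <= E) ->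
  \rsum_(j <- iota 0 K) g (node j) = 0 ->
  Rabs (\rsum_(n <- iota 1 N) g (x n)) <= L * E + INR N * (L / INR K).
Proof.
move=> x01 cntE g0.
pose G y := \rsum_(j <- iota 0 K) (if Rlt_dec y (node j.+1) then incr j else 0).
have node1 : node K = 1 by rewrite /node; field; lra.
have -> : \rsum_(n <- iota 1 N) g (x n) =
    \rsum_(n <- iota 1 N) (g 1 - G (x n)) - \rsum_(n <- iota 1 N) (g 1 - G (x n) - g (x n)).
  by rewrite -rsum_sub; apply: eq_bigr => n _; ring.
have err : Rabs (\rsum_(n <- iota 1 N) (g 1 - G (x n) - g (x n))) <= INR N * (L / INR K).
  apply: Rle_trans (rsum_abs _ _) _.
  rewrite -{2}(size_iota 1 N) -rsum_const; apply: rsum_le => n _.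
  have := @step_approximation (x n) K (proj1 (x01 n)).
  by rewrite node1; case: Rlt_dec => // ?; have := x01 n; lra.
have main : \rsum_(n <- iota 1 N) (g 1 - G (x n)) =
    \rsum_(j <- iota 0 K) (incr j * (INR N * node j.+1 - INR (count_in x 0 (node j.+1) N))).
  rewrite rsum_sub rsum_const size_iota exchange_big /=.
  rewrite [RHS](eq_bigr (fun j => INR N / INR K * (incr j * INR j.+1) -
     \rsum_(n <- iota 1 N) (if Rlt_dec (x n) (node j.+1) then incr j else 0))); last first.
    move=> j _; rewrite count_in_rsum; last by move=> n; case: (x01 n).
    rewrite Rmult_minus_distr_l; congr (_ - _); first by rewrite /node; field; lra.
    rewrite -rsum_scal; apply: eq_bigr => n _.
    by case: Rlt_dec => ? /=; ring.
  rewrite rsum_sub rsum_scal abel_incr g0 node1; congr (_ - _); field; lra.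
have mainle : Rabs (\rsum_(n <- iota 1 N) (g 1 - G (x n))) <= L * E.
  rewrite main; apply: Rle_trans (rsum_abs _ _) _.
  rewrite (_ : L * E = INR (size (iota 0 K)) * (L / INR K * E)); last first.
    by rewrite size_iota; field; lra.
  rewrite -rsum_const; apply: rsum_le => j; rewrite mem_iota add0n => /andP[_ jK].
  rewrite Rabs_mult; apply: Rmult_le_compat; try exact: Rabs_pos.
    apply: Rle_trans (g_lip _ _) _; rewrite nodeS.
    rewrite (_ : node j + / INR K - node j = / INR K); last by ring.
    by rewrite Rabs_pos_eq; [apply: Rle_refl|apply/Rlt_le/Rinv_0_lt_compat].
  rewrite Rabs_minus_sym; apply: cntE; split.
    by rewrite /node; apply: Rdiv_lt_0_compat => //; apply: lt_0_INR; lia.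
  by rewrite /node; apply: Rdiv_le_of_le_mul => //; rewrite Rmult_1_l; apply: le_INR; lia.
apply: Rle_trans (Rabs_triang _ _) _; rewrite Rabs_Ropp; lra.
Qed.

End Koksma.

Lemma koksma_cos (x : nat -> R) (N h : nat) (phi : R) :
  (0 < N)%N -> (0 < h)%N -> (forall n, 0 <= x n < 1) ->
  Rabs (\rsum_(n <- iota 1 N) cos (2 * PI * INR h * x n + phi)) <=
  2 * PI * INR h * (INR N * discrepancy x N).
Proof.
move=> N0 h0 x01; have PI0 := PI_RGT_0.
have h0' : 0 < INR h by apply: lt_0_INR; lia.
pose L := 2 * PI * INR h; have L0 : 0 < L by apply: Rmult_lt_0_compat; lra.
apply: Rle_plus_epsilon => eps eps0.
have [K0 K0_gt] := INR_unbounded (INR N * L / eps).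
(* [K0] makes the mesh error at most [eps]; [K > h] prevents [K] from dividing [h], so that the node
   sum vanishes. *)
pose K := maxn K0 h.+1.
have K0K : INR K0 <= INR K by apply: le_INR; rewrite /K; lia.
have K_gt0 : 0 < INR K by apply: lt_0_INR; rewrite /K; lia.
apply: Rle_trans (@koksma_step (fun y => cos (2 * PI * INR h * y + phi)) L K _ _ x N
  (INR N * discrepancy x N) x01 _ _) _.
- by rewrite /K; lia.
- move=> y z; apply: Rle_trans (cos_lipschitz _ _) _.
  rewrite (_ : _ - _ = L * (y - z)); last by rewrite /L; ring.
  by rewrite Rabs_mult (Rabs_pos_eq L); lra.
- by move=> b [b0 b1]; have := @discrepancy_ge x N 0 b N0; rewrite Rminus_0_r; apply; lra.
- rewrite -[RHS](@rsum_cos_period K 1 (Z.of_nat h) phi).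
  + rewrite mul1n; apply: eq_bigr => j _; congr (cos (_ + _)).
    by rewrite -INR_IZR_INZ; field; lra.
  + by rewrite /K; lia.
  + by move=> /Z.divide_pos_le; rewrite /K; lia.
- apply: Rplus_le_compat_l.
  have : INR N * L / eps * eps <= INR K * eps by apply: Rmult_le_compat_r; lra.
  rewrite (_ : INR N * L / eps * eps = INR N * L); last by field; lra.
  move=> le1; rewrite (_ : INR N * (L / INR K) = INR N * L / INR K); last by field; lra.
  by apply: Rdiv_le_of_le_mul; lra.
Qed.

Lemma frac_bounds (y : R) : 0 <= frac y < 1.
Proof. by have [/Rge_le ? ?] := base_fp y. Qed.

Lemma cos_frac (k : Z) (y phi : R) :
  cos (2 * PI * IZR k * frac y + phi) = cos (2 * PI * IZR k * y + phi).
Proof.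
rewrite -(cos_periodZ _ (k * Int_part y)); congr cos.
by rewrite /frac /frac_part mult_IZR; ring.
Qed.

(** * Null sets *)

Lemma rsum_ge0 I (r : seq I) (F : I -> R) :
  (forall i, 0 <= F i) -> 0 <= \rsum_(i <- r) F i.
Proof.
move=> F0; elim: r => [|i r IHr]; first by rewrite big_nil; lra.
by rewrite big_cons; have := F0 i; lra.
Qed.

Lemma rsum_subset (I : eqType) (r r' : seq I) (F : I -> R) :
  (forall i, 0 <= F i) -> uniq r -> {subset r <= r'} ->
  \rsum_(i <- r) F i <= \rsum_(i <- r') F i.
Proof.
move=> F0; elim: r r' => [|x r IHr] r' /=.
  by move=> _ _; rewrite big_nil; apply: rsum_ge0.
move=> /andP[xr r_uniq] sub; rewrite big_cons [X in _ <= X](big_rem x) /=; last first.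
  by apply: sub; rewrite mem_head.
apply/Rplus_le_compat_l/IHr => // y yr.
have : y \in r' by apply: sub; rewrite inE yr orbT.
move/perm_to_rem: (sub x (mem_head _ _)) => /perm_mem ->; rewrite inE => /orP[/eqP yx|//].
by move: xr; rewrite -yx yr.
Qed.

Lemma sum_f_R0_rsum (F : nat -> R) (n : nat) :
  sum_f_R0 F n = \rsum_(i <- iota 0 n.+1) F i.
Proof.
elim: n => [|n IHn]; first by rewrite big_seq1.
by rewrite rsum_iotaS -IHn.
Qed.

Lemma rsum_half_pow (eps : R) (n : nat) : 0 <= eps ->
  \rsum_(s <- iota 0 n) (eps * (/ 2) ^ s.+1) <= eps.
Proof.
move=> eps0; have -> : \rsum_(s <- iota 0 n) (eps * (/ 2) ^ s.+1) = eps * (1 - (/ 2) ^ n).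
  elim: n => [|n IHn]; first by rewrite big_nil /=; ring.
  by rewrite rsum_iotaS IHn add0n /=; field.
have : 0 < (/ 2) ^ n by apply: pow_lt; lra.
by nra.
Qed.

Lemma null_set_sub (S T : R -> Prop) : (forall y, S y -> T y) -> null_set T -> null_set S.
Proof.
move=> ST nT eps /nT[a [b [ab [cov tot]]]].
by exists a, b; split=> //; split=> // y /ST /cov.
Qed.

Lemma null_set_bigcup (S : nat -> R -> Prop) :
  (forall s, null_set (S s)) -> null_set (fun y => exists s, S s y).
Proof.
move=> nS eps eps0.
have pos s : 0 < eps * (/ 2) ^ s.+1.
  by apply: Rmult_lt_0_compat => //; apply: pow_lt; lra.
have ex s : exists ab : (nat -> R) * (nat -> R),
    (forall k, ab.1 k <= ab.2 k) /\ (forall y, S s y -> exists k, ab.1 k < y < ab.2 k) /\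
    (forall K, sum_f_R0 (fun k => ab.2 k - ab.1 k) K <= eps * (/ 2) ^ s.+1).
  by have [a [b H]] := nS s _ (pos s); exists (a, b).
have [f fP] : exists f : nat -> (nat -> R) * (nat -> R), forall s,
    (forall k, (f s).1 k <= (f s).2 k) /\
    (forall y, S s y -> exists k, (f s).1 k < y < (f s).2 k) /\
    (forall K, sum_f_R0 (fun k => (f s).2 k - (f s).1 k) K <= eps * (/ 2) ^ s.+1).
  exists (fun s => proj1_sig (constructive_indefinite_description _ (ex s))) => s.
  by case: constructive_indefinite_description.
(* Cantor's pairing merges the covers, the [s]-th of total length at most [eps / 2 ^ (s + 1)], into
   one sequence. *)
exists (fun k => (f (of_nat k).1).1 (of_nat k).2), (fun k => (f (of_nat k).1).2 (of_nat k).2).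
split; first by move=> k; case: (fP (of_nat k).1).
split=> [y [s Ssy]|K].
  have [_ [/(_ y Ssy)[k yk] _]] := fP s.
  by exists (to_nat (s, k)); rewrite cancel_of_to.
pose F (si : nat * nat) := (f si.1).2 si.2 - (f si.1).1 si.2.
have F0 si : 0 <= F si by rewrite /F; have [/(_ si.2) ? _] := fP si.1; lra.
rewrite sum_f_R0_rsum (eq_bigr (fun k => F (of_nat k))) // -(big_map of_nat xpredT F).
(* Neither coordinate of a pair exceeds its code, so the first [K.+1] pairs lie in a square. *)
apply: (@Rle_trans _ (\rsum_(si <- [seq (s, i) | s <- iota 0 K.+1, i <- iota 0 K.+1]) F si)).
  apply: rsum_subset => //.
    rewrite map_inj_uniq ?iota_uniq // => i j ij.
    by rewrite -(cancel_to_of i) -(cancel_to_of j) ij.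
  move=> si /mapP[k]; rewrite mem_iota => /andP[_ kK] ->{si}.
  have := cancel_to_of k; case: (of_nat k) => a b abk.
  have := to_nat_non_decreasing a b; rewrite abk => le_k.
  by apply: allpairs_f; rewrite mem_iota; lia.
rewrite big_allpairs; apply: Rle_trans (@rsum_half_pow eps K.+1 (Rlt_le _ _ eps0)).
apply: rsum_le => s _; have [_ [_ /(_ K)]] := fP s.
by rewrite sum_f_R0_rsum.
Qed.

(** Past its end the list is read as the pair [(0, 0)], an empty interval that covers nothing and
    adds no length. *)
Lemma null_set_finite_cover (S : R -> Prop) :
  (forall eps, 0 < eps -> exists l : seq (R * R),
    [/\ forall k, (nth (0, 0) l k).1 <= (nth (0, 0) l k).2,
        forall y, S y -> exists k, (nth (0, 0) l k).1 < y < (nth (0, 0) l k).2 &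
        \rsum_(ab <- l) (ab.2 - ab.1) <= eps]) ->
  null_set S.
Proof.
move=> cov eps /cov[l [ord_l cov_l tot]].
exists (fun k => (nth (0, 0) l k).1), (fun k => (nth (0, 0) l k).2); split=> //; split=> // K.
apply: Rle_trans tot; rewrite sum_f_R0_rsum.
elim: l K.+1 ord_l {cov_l} => [|ab l IHl] n ord_l.
  rewrite big_nil big1; first lra.
  by move=> k _; rewrite nth_nil /=; lra.
have ord_l' k : (nth (0, 0) l k).1 <= (nth (0, 0) l k).2 by exact: (ord_l k.+1).
case: n => [|n].
  rewrite big_nil (big_nth (0, 0)); apply: rsum_ge0 => k.
  by have := ord_l k; lra.
rewrite big_cons [iota _ _]/= big_cons /= (iotaDl 1 0) big_map; apply: Rplus_le_compat_l.
exact: IHl.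
Qed.

(** * Covering the sublevel sets of a cosine sum *)

Lemma cos_sum_lipschitz (r : seq Z) (W : nat) (x y : R) :
  {in r, forall w, (Z.abs_nat w <= W)%N} ->
  Rabs (cos_sum r x - cos_sum r y) <= INR (size r) * (2 * PI * INR W * Rabs (x - y)).
Proof.
move=> rW; rewrite -rsum_sub; apply: Rle_trans (rsum_abs _ _) _.
rewrite -rsum_const; apply: rsum_le => w /rW wW.
apply: Rle_trans (cos_lipschitz _ _) _.
rewrite (_ : _ - _ = (2 * PI * IZR w) * (x - y)); last by ring.
have PI0 := PI_RGT_0.
rewrite Rabs_mult; apply: Rmult_le_compat_r; first exact: Rabs_pos.
rewrite Rabs_mult (Rabs_pos_eq (2 * PI)); last by lra.
apply: Rmult_le_compat_l; first by lra.
by rewrite -abs_IZR INR_IZR_INZ; apply: IZR_le; lia.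
Qed.

Lemma mesh_point (z y t : R) (n : nat) : 0 < t -> z <= y < z + INR n * t ->
  exists2 i, (i < n)%N & z + INR i * t <= y < z + INR i * t + t.
Proof.
move=> t0; elim: n => [|n IHn]; first by rewrite /=; lra.
rewrite S_INR => yn; case: (Rlt_dec y (z + INR n * t)) => lt_y.
  by have [|i i_n yi] := IHn; [lra|exists i => //; lia].
by exists n => //; lra.
Qed.

(* Chebyshev's inequality on a mesh so fine that the Lipschitz bound transfers
   smallness from a point to the nearest mesh point. *)
Lemma cos_sum_sublevel_cover (r : seq Z) (M q : nat) (z : Z) (c eps : R) :
  0 < c -> {in r, forall w, w <> 0%Z} ->
  (forall v, v <> 0%Z -> (count (pred1 v) r <= M)%N) ->
  2 * INR q * INR M * INR (size r) / c ^ 2 <= eps ->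
  exists l : seq (R * R),
    [/\ forall k, (nth (0, 0) l k).1 <= (nth (0, 0) l k).2,
        forall y, IZR z <= y < IZR z + INR q -> cos_sum r y < - (2 * c) ->
          exists k, (nth (0, 0) l k).1 < y < (nth (0, 0) l k).2 &
        \rsum_(ab <- l) (ab.2 - ab.1) <= eps].
Proof.
move=> c0 r0 rM le_eps; have PI0 := PI_RGT_0.
pose W := (\max_(w <- r) Z.abs_nat w)%N.
have rW : {in r, forall w, (Z.abs_nat w <= W)%N}.
  by move=> w wr; apply: leq_bigmax_seq.
have [K1 K1_gt] := INR_unbounded (INR (size r) * (2 * PI * INR W) / c).
(* [K1] limits the change of the sum across a mesh cell to [c], so a value below [- (2 * c)] forces
   one below [- c] at the mesh point; the other term is the condition [2 * W < K] of the second
   moment. *)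
pose K := maxn K1 (2 * W).+1.
have K1K : INR K1 <= INR K by apply: le_INR; rewrite /K; lia.
have K0 : 0 < INR K by apply: lt_0_INR; rewrite /K; lia.
have iK0 : 0 < / INR K by apply: Rinv_0_lt_compat.
pose x i := IZR z + INR i / INR K.
pose bad i := if Rlt_dec (cos_sum r (x i)) (- c) then true else false.
pose J := [seq i <- iota 0 (q * K) | bad i].
(* The cell of [x i] is half-open and starts at [x i]; extending it to the left puts [x i] itself
   inside an open interval. *)
pose l := [seq (x i - / INR K, x i + / INR K) | i <- J].
exists l; split.
- move=> k; case: (ltnP k (size J)) => kJ; last by rewrite nth_default ?size_map //=; lra.
  by rewrite (nth_map 0%N) //=; lra.
- move=> y yz Fy.
  have [i iqK yi] : exists2 i, (i < q * K)%N & IZR z + INR i * / INR K <= y <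
      IZR z + INR i * / INR K + / INR K.
    apply: mesh_point => //; rewrite mult_INR.
    by rewrite (_ : INR q * INR K * / INR K = INR q) //; field; lra.
  have iJ : i \in J.
    rewrite mem_filter mem_iota /= iqK andbT /bad; case: Rlt_dec => // nlt; exfalso.
    have := @cos_sum_lipschitz r W (x i) y rW.
    have : Rabs (x i - y) <= / INR K by apply: Rabs_le; rewrite /x /Rdiv; lra.
    move=> h1; have h2 : INR (size r) * (2 * PI * INR W * Rabs (x i - y)) <= c.
      apply: (@Rle_trans _ (INR (size r) * (2 * PI * INR W) * / INR K)).
        rewrite [X in _ <= X]Rmult_assoc; apply: Rmult_le_compat_l; first exact: pos_INR.
        by apply: Rmult_le_compat_l => //; apply: Rmult_le_pos (pos_INR _); lra.
      apply: Rdiv_le_of_le_mul => //.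
      have : INR (size r) * (2 * PI * INR W) / c * c <= INR K * c.
        by apply: Rmult_le_compat_r; lra.
      by rewrite /Rdiv Rmult_assoc Rinv_l; lra.
    by move=> h3; have := Rle_abs (cos_sum r (x i) - cos_sum r y); lra.
  exists (index i J); rewrite (nth_map 0%N) ?index_mem // nth_index //= /x /Rdiv; lra.
- apply: Rle_trans le_eps.
  rewrite big_map (eq_bigr (fun _ => 2 * / INR K)); last by move=> i _ /=; lra.
  rewrite rsum_const.
  have moment := @cos_sum_second_moment r W K q M z.
  have {}moment : \rsum_(i <- iota 0 (q * K)) (cos_sum r (x i)) ^ 2 <=
      INR (q * K) * INR M * INR (size r).
    apply: moment => //; first by rewrite /K; lia.
    by move=> w wr; split; [apply: r0|apply: rW].
  have cheb : INR (size J) * c ^ 2 <= \rsum_(i <- iota 0 (q * K)) (cos_sum r (x i)) ^ 2.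
    rewrite size_filter -rsum_count Rmult_comm -rsum_scal; apply: rsum_le => i _.
    rewrite /bad; case: Rlt_dec => lt_c /=; nra.
  rewrite (_ : 2 * INR q * INR M * INR (size r) / c ^ 2 =
    (INR (q * K) * INR M * INR (size r)) / c ^ 2 * (2 * / INR K)); last first.
    by rewrite mult_INR; field; lra.
  apply: Rmult_le_compat_r; first lra.
  apply: (Rmult_le_reg_r (c ^ 2)); first by apply: pow_lt.
  rewrite /Rdiv Rmult_assoc Rinv_l; last by apply: Rgt_not_eq; apply: pow_lt.
  by rewrite Rmult_1_r; apply: Rle_trans cheb moment.
Qed.

(** * The energy estimate *)

(** The two squares come from the real and imaginary parts of [S_N(h x)]; expanding them and
    applying the formula for [cos (a - b)] gives the frequencies [h (p a - p b)]. *)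
Lemma cos_sum_triples (p : nat -> Z) (H N : nat) (x : R) :
  cos_sum [seq freq p t | t <- triples H N] x =
  \rsum_(h <- iota 1 H)
    ((\rsum_(n <- iota 1 N) cos (2 * PI * INR h * (IZR (p n) * x))) ^ 2 +
     (\rsum_(n <- iota 1 N) sin (2 * PI * INR h * (IZR (p n) * x))) ^ 2).
Proof.
rewrite /cos_sum big_map big_allpairs; apply: eq_bigr => h _.
rewrite big_allpairs /= !Rmult_1_r !big_distrlr -big_split /=.
apply: eq_bigr => a _; rewrite -big_split /=; apply: eq_bigr => b _.
rewrite -cos_minus; congr cos.
by rewrite /freq /= mult_IZR minus_IZR -INR_IZR_INZ; ring.
Qed.

Lemma cos_sum_filter0 (r : seq Z) (x : R) :
  cos_sum r x = cos_sum [seq w <- r | w != 0%Z] x + INR (count (pred1 0%Z) r).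
Proof.
elim: r => [|w r IHr]; first by rewrite /cos_sum !big_nil /=; lra.
rewrite [count _ _]/= plus_INR [filter _ _]/= {1}/cos_sum big_cons -/(cos_sum r x) IHr.
case: eqP => [->|_] /=.
  by rewrite (_ : 2 * PI * 0 * x = 0) ?cos_0; lra.
by rewrite {2}/cos_sum big_cons -/(cos_sum _ x); lra.
Qed.

(** The diagonal triples [a = b] already provide these zeros. *)
Lemma count_freq0 (p : nat -> Z) (H N : nat) :
  (H * N <= count (pred1 0%Z) [seq freq p t | t <- triples H N])%N.
Proof.
rewrite count_map -size_filter.
have -> : (H * N)%N = size [seq (h, (a, a)) | h <- iota 1 H, a <- iota 1 N].
  by rewrite size_allpairs !size_iota.
apply: uniq_leq_size.
  by apply: allpairs_uniq; rewrite ?iota_uniq // => -[? ?] [? ?] _ _ [-> ->].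
move=> t /allpairsP[[h a] /= [hH aN ->]]; rewrite mem_filter /= mem_triples.
move: hH aN; rewrite !mem_iota => hH aN; apply/andP; split; last by lia.
by apply/eqP; rewrite /freq /=; lia.
Qed.

Lemma size_triples H N : size (triples H N) = (H * N ^ 2)%N.
Proof. by rewrite !size_allpairs !size_iota; lia. Qed.

Lemma poly_evalZ_bound (c : nat -> Z) (d : nat) : exists C : nat, forall (x : Z) (X : nat),
  (0 < X)%N -> (Z.abs_nat x <= X)%N -> (Z.abs_nat (poly_evalZ c d x) <= C * X ^ d)%N.
Proof.
elim: d => [|d [C IHd]].
  by exists (Z.abs_nat (c 0%N)) => x X X0 xX; rewrite /= expn0; lia.
exists (C + Z.abs_nat (c d.+1))%N => x X X0 xX.
have powE : Z.abs_nat (x ^ Z.of_nat d.+1) = (Z.abs_nat x ^ d.+1)%N.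
  elim: (d.+1) => // n IHn.
  by rewrite Nat2Z.inj_succ Z.pow_succ_r ?Zabs2Nat.inj_mul ?IHn ?expnS //; lia.
have le_pow : (Z.abs_nat x ^ d.+1 <= X ^ d.+1)%N by rewrite leq_exp2r.
have le_d : (X ^ d <= X ^ d.+1)%N by rewrite leq_pexp2l.
rewrite -[poly_evalZ _ _ _]/(poly_evalZ c d x + c d.+1 * x ^ Z.of_nat d.+1)%Z.
apply: (@leq_trans (Z.abs_nat (poly_evalZ c d x) + Z.abs_nat (c d.+1 * x ^ Z.of_nat d.+1))%N).
  by lia.
rewrite mulnDl Zabs2Nat.inj_mul powE; apply: leq_add; last exact: leq_mul.
by apply: leq_trans (IHd x X X0 xX) _; rewrite leq_mul2l le_d orbT.
Qed.

Lemma polynomial_growth (c m : nat -> Z) (d t n0 : nat) :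
  (forall n, (n0 <= n)%N -> IZR (Z.abs (m n)) <= INR n ^ t) ->
  exists C A : nat, forall N n, (0 < n <= N)%N ->
    (Z.abs_nat (poly_evalZ c d (m n)) <= C * N ^ A)%N.
Proof.
move=> m_le; have [C CP] := poly_evalZ_bound c d.
(* Absorbs the finitely many terms before [n0], where no growth is assumed. *)
pose C1 := (\max_(n < n0) Z.abs_nat (m n))%N.
exists (C * C1.+1 ^ d)%N, (t * d)%N => N n /andP[n_gt0 nN].
have powN : (0 < N ^ t)%N by rewrite expn_gt0; lia.
rewrite -mulnA expnM -expnMn; apply: CP; first by lia.
have [n0n|nn0] := leqP n0 n; last first.
  have : (Z.abs_nat (m n) <= C1)%N by exact: (@leq_bigmax _ _ (Ordinal nn0)).
  by nia.
have le1 : (Z.abs_nat (m n) <= n ^ t)%N.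
  have powE k : INR n ^ k = INR (n ^ k).
    by elim: k => // k IHk; rewrite expnS mult_INR -IHk.
  apply/leP/INR_le; rewrite -powE; apply: Rle_trans (m_le n n0n).
  by rewrite INR_IZR_INZ; apply: IZR_le; lia.
have : (n ^ t <= N ^ t)%N by case: (t) => // t'; rewrite leq_exp2r.
by nia.
Qed.

(** Koksma's inequality with phases [0] and [- (PI / 2)] bounds both parts of [S_N(h x)] by
    [2 * PI * H * E]; the two squares add up to [8 * PI ^ 2 * H ^ 2 * E ^ 2]. *)
Lemma energy_upper_bound (p : nat -> Z) (H N : nat) (x E : R) :
  (0 < N)%N -> INR N * discrepancy (fun n => frac (IZR (p n) * x)) N <= E ->
  cos_sum [seq freq p t | t <- triples H N] x <= INR H * (8 * PI ^ 2 * INR H ^ 2 * E ^ 2).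
Proof.
move=> N0 DE; rewrite cos_sum_triples.
rewrite -[in X in _ <= X](size_iota 1 H) -rsum_const size_iota.
apply: rsum_le => h; rewrite mem_iota => /andP[h0 hH].
have PI0 := PI_RGT_0.
have h0' : 0 < INR h by apply: lt_0_INR; lia.
have hH' : INR h <= INR H by apply: le_INR; lia.
set u := fun n => frac (IZR (p n) * x) in DE.
have bnd phi : Rabs (\rsum_(n <- iota 1 N) cos (2 * PI * INR h * (IZR (p n) * x) + phi)) <=
    2 * PI * INR H * E.
  rewrite (eq_bigr (fun n => cos (2 * PI * INR h * u n + phi))); last first.
    by move=> n _; rewrite INR_IZR_INZ /u cos_frac.
  apply: Rle_trans (@koksma_cos u N h phi N0 h0 (fun n => frac_bounds _)) _.
  have D0 : 0 <= INR N * discrepancy u N.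
    apply: Rle_trans (Rabs_pos _) (@discrepancy_ge u N 0 1 N0 _ _ _); lra.
  apply: Rmult_le_compat => //; first by apply: Rmult_le_pos; lra.
  by apply: Rmult_le_compat_l; lra.
have sq (a b : R) : Rabs a <= b -> a ^ 2 <= b ^ 2.
  by move=> ab; rewrite -(pow2_abs a); apply: pow_incr; split=> //; exact: Rabs_pos.
have := sq _ _ (bnd 0); have := sq _ _ (bnd (- (PI / 2))).
under eq_bigr do rewrite -sin_cos_shift.
under [in X in _ -> X -> _]eq_bigr do rewrite Rplus_0_r.
move=> h1 h2; apply: Rle_trans (Rplus_le_compat _ _ _ _ h2 h1) _.
by right; ring.
Qed.

Definition nonzero_freqs (p : nat -> Z) (H N : nat) : seq Z :=
  [seq w <- [seq freq p t | t <- triples H N] | w != 0%Z].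

(* The divisor bound is used with an exponent so large that, for H = D * G ^ 2,
   the multiplicities are O(G), hence negligible against H. *)
Lemma nonzero_freqs_multiplicity (c m : nat -> Z) (d e C A : nat) :
  (2 <= d)%N -> c d <> 0%Z ->
  (forall i j, (0 < i)%N -> (0 < j)%N -> m i = m j -> i = j) ->
  (forall N n, (0 < n <= N)%N -> (Z.abs_nat (poly_evalZ c d (m n)) <= C * N ^ A)%N) ->
  exists2 D : nat, (0 < D)%N & forall G H v, (2 * C < G)%N ->
    H = (D * G ^ 2)%N -> v <> 0%Z ->
    (count (pred1 v) (nonzero_freqs (fun n => poly_evalZ c d (m n)) H (H ^ e))
       <= 2 * d * (D * G))%N.
Proof.
move=> d2 cd m_inj growth; set p := (X in nonzero_freqs X).
(* A frequency is at most [H * 2 C * N ^ A]; with [N = H ^ e] and [2 C < G <= H] this is at most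
   [H ^ B]. *)
pose B := (e * A).+2.
have [D D0 DP] := @divisor_bound (4 * B) isT.
exists D => // G H v CG HE v0; set N := (H ^ e)%N.
have G0 : (0 < G)%N by lia.
have GH : (G <= H)%N by rewrite HE expnS expn1; nia.
have -> : count (pred1 v) (nonzero_freqs p H N) = count (fun t => freq p t == v) (triples H N).
  rewrite count_filter count_map; apply: eq_count => t /=.
  by case: eqP => //= ->; apply/eqP.
have [v_in|] := boolP (has (fun t => freq p t == v) (triples H N)); last first.
  by rewrite has_count -leqNgt leqn0 => /eqP ->.
have vB : (Z.abs_nat v <= H ^ B)%N.
  have /hasP[[h [a b]] t_in /eqP <-] := v_in.
  move: t_in; rewrite mem_triples => /and3P[hH aN bN].
  have pa := growth N a aN; have pb := growth N b bN.
  rewrite -/(p a) -/(p b) in pa pb.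
  apply: (@leq_trans (H * (H * N ^ A))%N); last by rewrite /B !expnS -expnM.
  rewrite /freq /= Zabs2Nat.inj_mul Zabs2Nat.id; apply: leq_mul; first by lia.
  apply: (@leq_trans (2 * C * N ^ A)%N); first by lia.
  by rewrite leq_mul2r; apply/orP; right; lia.
apply: leq_trans (count_freq H N d2 cd v0 m_inj) _.
set tau := size _; have tau_le : (tau ^ (4 * B) <= (D * H) ^ B)%N.
  apply: leq_trans (DP _ _) _; first by lia.
  rewrite expnMn; apply: leq_mul => //.
  by rewrite -{1}(expn1 D) leq_pexp2l.
(* Taking [B]-th roots leaves [tau ^ 4 <= D * H = (D * G) ^ 2], which is why [H] has the form
   [D * G ^ 2]. *)
have {}tau_le : (tau ^ 2 <= D * G)%N.
  move: tau_le; rewrite expnM leq_exp2r // => le4.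
  rewrite -(@leq_exp2r _ _ 2) // -expnM; apply: leq_trans le4 _.
  by rewrite HE !expnS !expn0; lia.
by rewrite mulnAC leq_mul2l tau_le orbT.
Qed.

(** * Choice of parameters *)

Lemma INR_expn (a n : nat) : INR (a ^ n) = INR a ^ n.
Proof. by elim: n => // n IHn; rewrite expnS mult_INR IHn. Qed.

(** With [s = k + 2] the exponent of [H] is [2 s (1/2 - 1/s) = s - 2 = k]. *)
Lemma Rpower_half_sub (H k : nat) : (0 < H)%N ->
  Rpower (INR (H ^ (2 * k.+2))) (1 / 2 - / INR k.+2) = INR H ^ k.
Proof.
move=> H0; have H0' : 0 < INR H by apply: lt_0_INR; lia.
rewrite INR_expn -!Rpower_pow // Rpower_mult; congr Rpower.
have INR2 : INR 2 = 2 by [].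
have k0 : INR k.+2 <> 0 by apply: not_0_INR.
rewrite mult_INR; have -> : INR k = INR k.+2 - 2 by rewrite !S_INR; ring.
by rewrite INR2; field.
Qed.

(** For each [eps] a single [N = H ^ (2 s)] suffices: the points that are low at this [N] have
    non-zero-frequency sum below [- H N / 2], and in the bounded window they are covered with total
    length at most [128 s d / G], where [G] is free. *)
Lemma low_discrepancy_null (c m : nat -> Z) (d t n0 k : nat) :
  (2 <= d)%N -> c d <> 0%Z ->
  (forall i j, (0 < i)%N -> (0 < j)%N -> m i = m j -> i = j) ->
  (forall n, (n0 <= n)%N -> IZR (Z.abs (m n)) <= INR n ^ t) ->
  null_set (fun x => - INR k.+2 <= x < INR k.+2 /\
    forall N, (k.+2 <= N)%N ->
      INR N * discrepancy (fun n => frac (IZR (poly_evalZ c d (m n)) * x)) N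
        < Rpower (INR N) (1 / 2 - / INR k.+2)).
Proof.
move=> d2 cd m_inj m_le; have [C [A growth]] := polynomial_growth c d m_le.
set s := k.+2; have INR2 : INR 2 = 2 by [].
have [D D0 multP] := nonzero_freqs_multiplicity (2 * s) d2 cd m_inj growth.
set p := fun n => poly_evalZ c d (m n) in multP *.
apply: null_set_finite_cover => eps eps0.
have [G1 G1_gt] := INR_unbounded (128 * INR s * INR d / eps).
(* [G1] brings [128 s d / G] below [eps], [2 * C] serves the multiplicity bound, [17] gives
   [8 * PI ^ 2 < H ^ 2 / 2] by way of [PI <= 4], and [s] ensures [s <= N]. *)
pose G := (G1 + 2 * C + 17 + s)%N; pose H := (D * G ^ 2)%N; pose N := (H ^ (2 * s))%N.
have GH : (G <= H)%N by rewrite /H /G expnS expn1; nia.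
have HN : (H <= N)%N by rewrite /N -{1}(expn1 H) leq_pexp2l /s; lia.
have H17 : 17 <= INR H by rewrite (_ : 17 = INR 17); [apply: le_INR; lia|rewrite /=; ring].
have N0 : 0 < INR N by apply: lt_0_INR; lia.
have G0 : 0 < INR G by apply: lt_0_INR; lia.
have D0' : 0 < INR D by apply: lt_0_INR; lia.
pose r := nonzero_freqs p H N; pose c0 := INR H * INR N / 4.
have c0_gt0 : 0 < c0 by rewrite /c0; have := Rmult_lt_0_compat (INR H) (INR N); lra.
have rM v : v <> 0%Z -> (count (pred1 v) r <= 2 * d * (D * G))%N.
  by apply: multP => //; rewrite /G; lia.
have r0 : {in r, forall w, w <> 0%Z} by move=> w; rewrite mem_filter => /andP[/eqP].
have le_eps : 2 * INR (2 * s) * INR (2 * d * (D * G)) * INR (size r) / c0 ^ 2 <= eps.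
  have size_r : INR (size r) <= INR H * INR N ^ 2.
    rewrite -INR_expn -mult_INR; apply: le_INR; apply/leP.
    apply: (@leq_trans (size (triples H N))); last by rewrite size_triples.
    by rewrite -(size_map (freq p)) size_filter count_size.
  have HE : INR H = INR D * INR G ^ 2 by rewrite /H mult_INR INR_expn.
  apply: (@Rle_trans _ (2 * INR (2 * s) * INR (2 * d * (D * G)) * (INR H * INR N ^ 2) / c0 ^ 2)).
    apply: Rmult_le_compat_r; first by apply/Rlt_le/Rinv_0_lt_compat/pow_lt.
    apply: Rmult_le_compat_l => //.
    by do 2!(apply: Rmult_le_pos; last exact: pos_INR); lra.
  have -> : 2 * INR (2 * s) * INR (2 * d * (D * G)) * (INR H * INR N ^ 2) / c0 ^ 2 =
      128 * INR s * INR d / INR G.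
    rewrite /c0; move: (INR N) N0 => N' N'0; rewrite HE !mult_INR INR2.
    by field; repeat split; lra.
  apply: Rdiv_le_of_le_mul => //.
  have G1G : INR G1 <= INR G by apply: le_INR; rewrite /G; lia.
  have : 128 * INR s * INR d / eps * eps <= INR G * eps by apply: Rmult_le_compat_r; lra.
  by rewrite /Rdiv Rmult_assoc Rinv_l; lra.
have [l [ord_l cov_l tot_l]] :=
  @cos_sum_sublevel_cover r _ (2 * s) (- Z.of_nat s) c0 eps c0_gt0 r0 rM le_eps.
exists l; split=> // y [ys y_low]; apply: cov_l.
  by rewrite opp_IZR -INR_IZR_INZ mult_INR INR2; lra.
have sN : (s <= N)%N by rewrite /G in GH; lia.
have /Rlt_le := y_low N sN; rewrite /N Rpower_half_sub; last by lia.
rewrite -/N => /(@energy_upper_bound p H); rewrite cos_sum_filter0 -/(nonzero_freqs p H N) -/r.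
have N0' : (0 < N)%N by lia.
move=> /(_ N0').
have : INR H * INR N <= INR (count (pred1 0%Z) [seq freq p t | t <- triples H N]).
  by rewrite -mult_INR; apply: le_INR; apply/leP; apply: count_freq0.
(* Since [N = H ^ 4 * (H ^ k) ^ 2], the energy is at most [8 * PI ^ 2 * N / H], less than [H N / 2];
   the zero frequencies contribute at least [H N], so the others sum to less than [- H N / 2]. *)
have lt_half : INR H * (8 * PI ^ 2 * INR H ^ 2 * (INR H ^ k) ^ 2) < 2 * c0.
  have NE : INR N = INR H ^ 4 * (INR H ^ k) ^ 2.
    rewrite /N INR_expn -!pow_mult -pow_add; congr pow; rewrite /s; lia.
  have P0 : 0 < (INR H ^ k) ^ 2 by do 2!apply: pow_lt; lra.
  rewrite /c0 NE.
  rewrite (_ : INR H * _ = INR H ^ 3 * (INR H ^ k) ^ 2 * (8 * PI ^ 2)); last by ring.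
  rewrite (_ : 2 * _ = INR H ^ 3 * (INR H ^ k) ^ 2 * (INR H ^ 2 / 2)); last by field.
  apply: Rmult_lt_compat_l; first by apply: Rmult_lt_0_compat => //; apply: pow_lt; lra.
  by have := PI_4; have := PI_RGT_0; nra.
by rewrite /c0 in lt_half *; lra.
Qed.

End MeanEnergy.

(** * Countable union over exponents and bounded windows *)

Import MeanEnergy.
Open Scope R_scope.

Theorem theorem1 (d : nat) (c : nat -> Z) (m : nat -> Z) :
  (2 <= d)%nat ->
  c d <> 0%Z ->
  (forall i j : nat, (1 <= i)%nat -> (1 <= j)%nat -> i <> j -> m i <> m j) ->
  (exists (t n0 : nat), forall n : nat, (n0 <= n)%nat ->
       IZR (Z.abs (m n)) <= INR n ^ t) ->
  null_set (fun alpha : R =>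
    ~ (forall eps : R, 0 < eps ->
         forall N0 : nat, exists N : nat, (N0 <= N)%nat /\ (1 <= N)%nat /\
           INR N * discrepancy (fun n => frac (IZR (poly_evalZ c d (m n)) * alpha)) N
             >= Rpower (INR N) (1/2 - eps))).
Proof.
intros d2 cd m_inj [t [n0 m_le]].
assert (leP : forall a b : nat, ssrbool.reflect (a <= b)%nat (ssrnat.leq a b))
  by (intros a b; apply ssrnat.leP).
eapply null_set_sub; cycle 1.
- apply null_set_bigcup; intro k.
  apply (@low_discrepancy_null c m d t n0 k).
  + now apply (ssrbool.introT (leP _ _)).
  + exact cd.
  + intros i j i0 j0 mij; destruct (Nat.eq_dec i j) as [|ij]; [assumption|exfalso].
    now apply (m_inj i j); try apply (ssrbool.elimT (leP _ _)).
  + intros n n0n; apply m_le; now apply (ssrbool.elimT (leP _ _)).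
- intros x bad.
  apply not_all_ex_not in bad as [eps bad].
  apply imply_to_and in bad as [eps0 bad].
  apply not_all_ex_not in bad as [N0 bad].
  (* One [k] exceeding [N0], [1 / eps] and [|x|] makes the lower bound on [N], the exponent and the
     window fit at the same time. *)
  destruct (INR_unbounded (INR N0 + / eps + Rabs x)) as [k k_gt].
  assert (ieps0 : 0 < / eps) by now apply Rinv_0_lt_compat.
  pose proof (pos_INR N0); pose proof (Rabs_pos x).
  assert (kS : INR (S (S k)) = INR k + 2) by (rewrite !S_INR; ring).
  exists k; split.
  + pose proof (Rle_abs x); pose proof (Rle_abs (- x)); rewrite Rabs_Ropp in *; lra.
  + intros N kN; apply (ssrbool.elimT (leP _ _)) in kN.
    assert (N0N : (N0 <= N)%nat).
    { apply INR_le; apply le_INR in kN; lra. }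
    assert (N1 : 1 <= INR N) by (apply (le_INR 1); lia).
    apply Rnot_ge_lt; intro ge; apply bad; exists N.
    split; [exact N0N|split; [lia|]].
    apply Rge_trans with (1 := ge), Rle_ge, Rle_Rpower; [exact N1|].
    assert (/ INR (S (S k)) <= eps); [|lra].
    rewrite <- (Rinv_inv eps); apply Rinv_le_contravar; lra.
Qed.
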